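(* Let $K$ be a number field and let $E$ be an elliptic curve defined over $K$. Let $N$ be the absolute norm of the conductor ideal of $E/K$, let $\Delta_K$ be the absolute discriminant of $K/\mathbb{Q}$, and let $L(E,s)$ be the (Hasse--Weil) $L$-function of $E/K$. Assume that $L(E,s)$ admits an analytic continuation to $s=1$ and satisfies the functional equation relating $s$ and $2-s$ (in the precise sense given in the context). Let $$L(E,s) = a_r\,(s-1)^r + a_{r+1}\,(s-1)^{r+1} + \cdots, \qquad a_r \neq 0,$$ be the Taylor expansion of $L(E,s)$ at $s=1$, so that $r\geq 0$ is the order of vanishing of $L(E,s)$ at $s=1$. Then $$a_{r+1} = \Bigl( [K:\mathbb{Q}]\cdot(\gamma + \log(2\pi)) - \tfrac{1}{2}\log(N) - \log \vert\Delta_K\vert \Bigr) \cdot a_r,$$ where $\gamma = 0.577216\dots$ is Euler's constant.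
   Context: The $L$-function of $E/K$ is defined for $\operatorname{Re}(s)>3/2$ by the Euler product $L(E,s)=\prod_{v} L_v(q_v^{-s})^{-1}$ over the finite places $v$ of $K$, where $q_v$ is the cardinality of the residue field $k_v$ at $v$. Here $L_v(T)=1-a_vT+q_vT^2$ with $a_v=q_v+1-\#\tilde E(k_v)$, where $\tilde E$ is the reduction of $E$ at $v$, if $E$ has good reduction at $v$; and $L_v(T)=1-T$, $1+T$, or $1$ if $E$ has split multiplicative, non-split multiplicative, or additive reduction at $v$, respectively. Assumption on analytic continuation and functional equation: $L(E,s)$ extends to a holomorphic function, still denoted $L(E,s)$, on a connected open set $U\subseteq\mathbb{C}$ that contains the half-plane $\operatorname{Re}(s)>3/2$ and the point $s=1$ and is stable under $s\mapsto 2-s$ (for instance $U=\mathbb{C}$). Moreover, setting $n=[K:\mathbb{Q}]$, $B=\sqrt{N}\cdot|\Delta_K|/(2\pi)^n$ and $$\Lambda(s)=B^s\cdot\Gamma(s)^n\cdot L(E,s),$$ there is a sign $w\in\{+1,-1\}$ such that $\Lambda(s)=w\cdot\Lambda(2-s)$ as meromorphic functions on $U$. *)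

(* Defs.v *)
From HB Require Import structures.
From mathcomp Require Import all_boot all_order all_algebra all_field finmap.
From mathcomp Require Import all_classical all_reals all_analysis.
From mathcomp Require Import complex.

Set Implicit Arguments.
Unset Strict Implicit.
Unset Printing Implicit Defensive.

Import Order.TTheory GRing.Theory Num.Theory.
Import numFieldNormedType.Exports.

Local Open Scope classical_set_scope.
Local Open Scope ring_scope.
Local Open Scope quotient_scope.

(* R[i] seen as an abstract numClosedFieldType, so as to inherit the topology and
   the normed structure (over itself) of such fields: for f : cplx R -> cplx R,
   [derivable f s 1] is complex derivability at s *)
Definition cplx (R : realType) : numClosedFieldType := R[i].

Definition card_set (T : choiceType) (A : set T) : nat := #|` fset_set A|.

(* y^2 + a1 x y + a3 y = x^3 + a2 x^2 + a4 x + a6 *)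

Record weier (R : Type) := Weier { wa1 : R; wa2 : R; wa3 : R; wa4 : R; wa6 : R }.

HB.instance Definition _ (R : Type) := gen_eqMixin (weier R).
HB.instance Definition _ (R : Type) := gen_choiceMixin (weier R).

Definition map_weier (R S : Type) (f : R -> S) (W : weier R) : weier S :=
  Weier (f (wa1 W)) (f (wa2 W)) (f (wa3 W)) (f (wa4 W)) (f (wa6 W)).

Definition wdisc (R : comNzRingType) (W : weier R) : R :=
  let: Weier a1 a2 a3 a4 a6 := W in
  let b2 := a1 ^+ 2 + 4 * a2 in
  let b4 := 2 * a4 + a1 * a3 in
  let b6 := a3 ^+ 2 + 4 * a6 in
  let b8 := a1 ^+ 2 * a6 + 4 * a2 * a6 - a1 * a3 * a4 + a2 * a3 ^+ 2
            - a4 ^+ 2 in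
  - b2 ^+ 2 * b8 - 8 * b4 ^+ 3 - 27 * b6 ^+ 2 + 9 * b2 * b4 * b6.

Definition elliptic (F : fieldType) (W : weier F) : bool := wdisc W != 0.

Definition weqn (R : comNzRingType) (W : weier R) (x y : R) : R :=
  let: Weier a1 a2 a3 a4 a6 := W in
  y ^+ 2 + a1 * x * y + a3 * y - x ^+ 3 - a2 * x ^+ 2 - a4 * x - a6.

Definition weqn_x (R : comNzRingType) (W : weier R) (x y : R) : R :=
  wa1 W * y - 3 * x ^+ 2 - 2 * wa2 W * x - wa4 W.
Definition weqn_y (R : comNzRingType) (W : weier R) (x y : R) : R :=
  2 * y + wa1 W * x + wa3 W.

Section Curve.
Variables (F : fieldType) (W : weier F).

(* points of the projective curve: None is the point at infinity *)
Definition on_curve (P : option (F * F)) : bool :=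
  if P is Some (x, y) then weqn W x y == 0 else true.

Definition wadd (P Q : option (F * F)) : option (F * F) :=
  match P, Q with
  | None, _ => Q
  | _, None => P
  | Some (x1, y1), Some (x2, y2) =>
    let: Weier a1 a2 a3 a4 a6 := W in
    if (x1 == x2) && (y1 + y2 + a1 * x2 + a3 == 0) then None else
    let d := 2 * y1 + a1 * x1 + a3 in
    let lam := if x1 != x2 then (y2 - y1) / (x2 - x1)
               else (3 * x1 ^+ 2 + 2 * a2 * x1 + a4 - a1 * y1) / d in
    let nu := if x1 != x2 then (y1 * x2 - y2 * x1) / (x2 - x1)
              else (- x1 ^+ 3 + a4 * x1 + 2 * a6 - a3 * y1) / d in
    let x3 := lam ^+ 2 + a1 * lam - a2 - x1 - x2 in
    Some (x3, - (lam + a1) * x3 - nu - a3)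
  end.

Definition wtorsion (l : nat) : set (option (F * F)) :=
  [set P | on_curve P /\ iter l (wadd P) None = None].

Definition singular_pt (x y : F) : bool :=
  [&& weqn W x y == 0, weqn_x W x y == 0 & weqn_y W x y == 0].

(* polynomial whose roots are the slopes of the tangents at a singular point of
   abscissa x: the quadratic part of the equation there is
   Y^2 + a1 X Y - (a2 + 3 x) X^2 *)
Definition tangent_poly (x : F) : {poly F} :=
  'X^2 + (wa1 W)%:P * 'X - (wa2 W + 3 * x)%:P.

Definition has_node : Prop :=
  exists x y, singular_pt x y /\ separable_poly (tangent_poly x).

Definition has_split_node : Prop :=
  exists x y, singular_pt x y /\
  exists m1 m2, m1 != m2 /\ tangent_poly x = ('X - m1%:P) * ('X - m2%:P).

(* result of the substitution x := u^2 x + r, y := u^3 y + s u^2 x + t *)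
Definition wchange (u r s t : F) : weier F :=
  let: Weier a1 a2 a3 a4 a6 := W in
  Weier ((a1 + 2 * s) / u)
        ((a2 - s * a1 + 3 * r - s ^+ 2) / u ^+ 2)
        ((a3 + r * a1 + 2 * t) / u ^+ 3)
        ((a4 - s * a3 + 2 * r * a2 - (t + r * s) * a1 + 3 * r ^+ 2
          - 2 * s * t) / u ^+ 4)
        ((a6 + r * a4 + r ^+ 2 * a2 + r ^+ 3 - t * a3 - t ^+ 2
          - r * t * a1) / u ^+ 6).

Definition wisom (W' : weier F) : Prop :=
  exists u r s t, u != 0 /\ W' = wchange u r s t.

End Curve.

(* The finite places of a number field are its normalized discrete valuations
   v : K -> Z u {oo}. The value v(0) = oo is replaced by the junk value 0, so
   that distinct elements of [place K] are distinct valuations. *)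

Record place (K : fieldType) := Place {
  pval :> K -> int;
  pval0 : pval 0 = 0;
  pvalM : forall x y, x != 0 -> y != 0 -> pval (x * y) = pval x + pval y;
  pvalD : forall x y, x != 0 -> y != 0 -> x + y != 0 ->
    Order.min (pval x) (pval y) <= pval (x + y);
  pval_surj : exists2 x, x != 0 & pval x = 1
}.

HB.instance Definition _ (K : fieldType) := gen_eqMixin (place K).
HB.instance Definition _ (K : fieldType) := gen_choiceMixin (place K).

(* v(x) >= n, with v(0) = oo *)
Definition vge (K : fieldType) (v : place K) (n : int) : {pred K} :=
  fun x => (x == 0) || (n <= v x).

Section Place.
Variables (K : fieldType) (v : place K).

Lemma pval1 : v 1 = 0.
Proof.
have := @pvalM K v 1 1 (oner_neq0 _) (oner_neq0 _).
by rewrite mulr1 => /eqP; rewrite -subr_eq0 opprD addrA subrr add0r oppr_eq0 => /eqP.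
Qed.

Lemma pvalN x : v (- x) = v x.
Proof.
have n1 : v (-1) = 0.
  have N0 : (-1 : K) != 0 by rewrite oppr_eq0 oner_neq0.
  have := pvalM v N0 N0; rewrite mulrNN mulr1 pval1 => /esym/eqP.
  by rewrite -mulr2n mulrn_eq0 /= => /eqP.
have [->|x0] := eqVneq x 0; first by rewrite oppr0.
by rewrite -mulN1r pvalM ?oppr_eq0 ?oner_neq0// n1 add0r.
Qed.

Lemma vgeN n x : vge v n (- x) = vge v n x.
Proof. by rewrite /vge pvalN oppr_eq0. Qed.

Lemma vgeD n x y : vge v n x -> vge v n y -> vge v n (x + y).
Proof.
rewrite /vge; have [->|x0] := eqVneq x 0; first by rewrite add0r.
have [->|y0] := eqVneq y 0; first by rewrite addr0 (negPf x0).
have [//|xy0] /= := eqVneq (x + y) 0; move=> nx ny.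
by apply: le_trans (pvalD v x0 y0 xy0); rewrite le_min nx ny.
Qed.

Lemma vgeM m n x y : vge v m x -> vge v n y -> vge v (m + n) (x * y).
Proof.
rewrite /vge; have [->|x0] := eqVneq x 0; first by rewrite mul0r eqxx.
have [->|y0] := eqVneq y 0; first by rewrite mulr0 eqxx.
by rewrite pvalM //= => mx ny; rewrite lerD ?orbT.
Qed.

Definition vint : {pred K} := vge v 0.

Lemma vint_subring : subring_closed vint.
Proof.
split=> [|x y|x y]; rewrite !unfold_in /=.
- by rewrite /vint /vge pval1 lexx orbT.
- by move=> hx hy; apply: vgeD => //; rewrite vgeN.
- by move=> hx hy; have := vgeM hx hy; rewrite addr0.
Qed.

HB.instance Definition _ := GRing.isSubringClosed.Build K vint vint_subring.

Record valring := ValRing { vval : K; _ : vval \in vint }.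
HB.instance Definition _ := [isSub for vval].
HB.instance Definition _ := [Choice of valring by <:].
HB.instance Definition _ := [SubChoice_isSubComNzRing of valring by <:].

Definition vmax : {pred valring} := fun x => vge v 1 (vval x).

Lemma vmax_zmod : zmod_closed vmax.
Proof.
split=> [|x y]; rewrite !unfold_in /vmax /=; first by rewrite /vge eqxx.
by move=> hx hy; apply: vgeD => //; rewrite vgeN.
Qed.

Lemma vmax_proper : ring_quotient.proper_ideal vmax.
Proof.
split=> [|[a ia] x]; rewrite !unfold_in /vmax /=.
  by rewrite /vge oner_eq0 pval1.
by move=> hx; rewrite unfold_in /= in ia; have := vgeM ia hx; rewrite add0r.
Qed.

HB.instance Definition _ := GRing.isZmodClosed.Build valring vmax vmax_zmod.
HB.instance Definition _ := isProperIdeal.Build valring vmax vmax_proper.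

Definition vmax_ideal : idealr valring := vmax.

Definition residue := {ideal_quot vmax_ideal}.
HB.instance Definition _ := GRing.ComNzRing.on residue.
HB.instance Definition _ := EqQuotient.on residue.

Definition res_inv (x : residue) : residue := xget 0 [set y | y * x = 1].

Lemma res_mulVf (x : residue) : x != 0 -> res_inv x * x = 1.
Proof.
move=> x0; rewrite /res_inv; case: xgetP => [y -> //|nex]; exfalso.
move: x0; rewrite -[x]reprK; set a := repr x => xa0.
have na : ~~ vge v 1 (vval a).
  apply: contra xa0 => ha; rewrite -[eqbRHS](rmorph0 \pi_residue).
  by rewrite -Quotient.idealrBE subr0.
have ia : vge v 0 (vval a) by case: (a).
move: na ia; rewrite /vge negb_or => /andP[a0 na]; rewrite (negPf a0) /= => ia.
have va0 : v (vval a) = 0.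
  apply/le_anti; rewrite ia andbT; move: na; rewrite -ltNge.
  by rewrite -[1]add0r ltzD1.
have va'0 : v (vval a)^-1 = 0.
  have a'0 : (vval a)^-1 != 0 by rewrite invr_eq0.
  by have := pvalM v a0 a'0; rewrite divff// pval1 va0 add0r.
have ia' : (vval a)^-1 \in vint by rewrite unfold_in /vint /vge va'0 lexx orbT.
apply: (nex (\pi_residue (ValRing ia'))).
rewrite /mkset -[x]reprK -/a.
rewrite -rmorphM -[RHS](rmorph1 \pi_residue).
by congr (\pi_residue _); apply: val_inj; rewrite /= mulVf.
Qed.
Lemma res_inv0 : res_inv 0 = 0.
Proof.
rewrite /res_inv; case: xgetP => // y -> /=; rewrite mulr0 => /esym/eqP.
by rewrite oner_eq0.
Qed.

HB.instance Definition _ := GRing.ComNzRing_isField.Build residue res_mulVf res_inv0.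

End Place.

(* reduction of the v-integral elements; the others are sent to 0 *)
Definition redv (K : fieldType) (v : place K) (x : K) : residue v :=
  \pi_(residue v) (insubd 0 x).

Definition qv (K : fieldType) (v : place K) : nat :=
  card_set [set: residue v].

Section LocalData.
Variables (K : fieldType) (v : place K) (E : weier K).

Definition integral_model (W : weier K) : Prop :=
  wisom E W /\
  [/\ wa1 W \in vint v, wa2 W \in vint v, wa3 W \in vint v, wa4 W \in vint v
    & wa6 W \in vint v].

Definition minimal_model (W : weier K) : Prop :=
  integral_model W /\
  forall W', integral_model W' -> v (wdisc W) <= v (wdisc W').

(* the reduction of a minimal model at v, well defined up to isomorphism *)
Definition reduction : weier (residue v) :=
  map_weier (redv v) (xget E [set W | minimal_model W]).

Definition good_red : Prop := elliptic reduction.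
Definition mult_red : Prop := ~ good_red /\ has_node reduction.
Definition split_mult_red : Prop := ~ good_red /\ has_split_node reduction.

Definition npoints : nat :=
  card_set [set P : option (residue v * residue v) | on_curve reduction P].

Definition trace_frob : int := (qv v).+1%:Z - npoints%:Z.

Definition local_factor : {poly int} :=
  if `[< good_red >] then 1 - trace_frob *: 'X + (qv v)%:Z *: 'X^2
  else if `[< split_mult_red >] then 1 - 'X
  else if `[< mult_red >] then 1 + 'X
  else 1.

End LocalData.

Section Wild.
Variables (K : fieldType) (v : place K) (E : weier K) (l : nat).
Variables (L : splittingFieldType K) (w : place L).

Definition lies_over : Prop := forall x : K, 0 < v x -> 0 < w (x%:A).

(* the i-th ramification group (lower numbering) of L/K at w; its elements
   preserve w, hence belong to the decomposition group *)
Definition ramif (i : nat) : {set gal_of {:L}} :=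
  [set g in 'Gal({:L} / 1)%g |
    `[< forall x, x \in vint w -> vge w i.+1%:Z (g x - x) >]]%SET.

Definition tors_pts : set (option (L * L)) :=
  wtorsion (map_weier (in_alg L) E) l.

Definition gal_pt (g : gal_of {:L}) (P : option (L * L)) : option (L * L) :=
  omap (fun p => (g p.1, g p.2)) P.

(* L = K(E[l]); over an algebraic closure of K, E[l] has l^2 elements *)
Definition torsion_field : Prop :=
  card_set tors_pts = (l ^ 2)%N /\
  forall M : {subfield L},
    (forall x y, tors_pts (Some (x, y)) -> x \in M /\ y \in M) ->
    (M = fullv :> {vspace L}).

(* dim_{F_l} (E[l] / E[l]^{G_i}) *)
Definition codim_inv (i : nat) : nat :=
  (2 - logn l (card_set
    [set P | tors_pts P /\ forall g, g \in ramif i -> gal_pt g P = P]))%N.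

Definition swan : rat :=
  \sum_(i \in [set i : nat | (0 < i)%N])
    (#|ramif i|%:R / #|ramif 0|%:R * (codim_inv i)%:R : rat).

End Wild.

(* the wild part delta_v of the exponent of the conductor; the value of [swan] is
   a natural number, and does not depend on the choice of l and w *)
Definition wild_exponent (K : fieldType) (v : place K) (E : weier K) : nat :=
  xget 0%N [set d : nat | exists (l : nat) (L : splittingFieldType K) (w : place L),
    [/\ prime l, l%:R != 0 :> residue v, torsion_field E l L, lies_over v w
      & d%:R = swan E l w]].

Definition cond_exponent (K : fieldType) (v : place K) (E : weier K) : nat :=
  if `[< good_red v E >] then 0%N
  else if `[< mult_red v E >] then 1%N
  else (2 + wild_exponent v E)%N.

(* the absolute norm of the conductor, i.e. of the product of the p_v^{f_v} *)
Definition cond_norm (K : fieldExtType rat) (E : weier K) : nat :=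
  \big[muln/1%N]_(v \in [set: place K]) (qv v ^ cond_exponent v E)%N.

Section Disc.
Variable K : fieldExtType rat.
Local Notation n := (\dim {:K}).

Definition field_trace (x : K) : rat :=
  \sum_(i < n) coord (vbasis {:K}) i (x * (vbasis {:K})`_i).

Definition integral_basis (b : n.-tuple K) : Prop :=
  (forall i : 'I_n, integralOver (intr : int -> K) b`_i) /\
  forall x : K, integralOver (intr : int -> K) x ->
    exists! c : {ffun 'I_n -> int}, x = \sum_(i < n) (c i)%:~R * b`_i.

(* independent of the choice of the integral basis, which always exists *)
Definition disc : rat :=
  xget 1 [set d | exists2 b : n.-tuple K, integral_basis b &
    d = \det (\matrix_(i < n, j < n) field_trace (b`_i * b`_j))].

End Disc.

Section Analytic.
Variable R : realType.
Implicit Types (x : R) (s : cplx R).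

(* x ^ s, for x > 0 *)
Definition cpow x s : cplx R :=
  (expR (complex.Re s * ln x) * cos (complex.Im s * ln x) +i*
   (expR (complex.Re s * ln x) * sin (complex.Im s * ln x)))%C.

(* Euler's formula for the Gamma function, valid at all s but the poles *)
Definition cGamma s : cplx R :=
  lim ((fun n : nat => n`!%:R * cpow n%:R s / \prod_(k < n.+1) (s + k%:R))
       @ \oo).

Definition gamma_pole s : Prop := exists k : nat, s = - k%:R.

Definition euler_gamma : R :=
  lim ((fun n : nat => \sum_(1 <= k < n.+1) k%:R^-1 - ln n%:R) @ \oo).

Variables (K : fieldExtType rat) (E : weier K).

(* the Euler product, ordered by norm (it converges absolutely for Re s > 3/2) *)
Definition euler_product s : cplx R :=
  lim ((fun n : nat =>
    \big[*%R/1]_(v \in [set v : place K | (qv v <= n)%N])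
      ((map_poly intr (local_factor v E)).[cpow (qv v)%:R (- s)])^-1) @ \oo).

Definition cond_B : R :=
  Num.sqrt (cond_norm E)%:R * `|ratr (disc K)| / (2 * pi) ^+ \dim {:K}.

(* Lambda(s), for the function L extending the L-function of E *)
Definition completedL (L : cplx R -> cplx R) s : cplx R :=
  cpow cond_B s * cGamma s ^+ \dim {:K} * L s.

End Analytic.

(* Main.v *)
(* Near s = 1 write s = 1 + h with h real and small; only such s matter. There
   log Gamma(1 + h) = - gamma h + O(h^2), so the factor F(h) of L(E, 1 + h) in
   Lambda(1 + h) satisfies F(h) / F(-h) = 1 + 2 c h + O(h^2) with
   c = log B - n gamma. Put L(E, 1 + h) = h^r g(h). The functional equation reads
   (F(h) / F(-h)) g(h) = w (-1)^r g(-h): letting h tend to 0 gives w (-1)^r = 1, and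
   comparing the terms of order h gives c a_r = - a_{r+1}.
   The formula for log B needs B > 0. The norm of the conductor is positive as the
   residue fields are finite: any n + 1 elements of K satisfy an integer relation
   not divisible by p, so the residue field has dimension at most n over F_p. The
   discriminant is nonzero because the trace form is nondegenerate. *)

Require Import Defs.
From mathcomp Require Import all_boot all_order all_algebra all_field.
From mathcomp Require Import all_classical all_reals all_analysis.
From mathcomp Require Import complex.
From mathcomp Require Import ring lra.

Set Implicit Arguments.
Unset Strict Implicit.
Unset Printing Implicit Defensive.

Import Order.TTheory GRing.Theory Num.Theory.
Import numFieldNormedType.Exports.

Local Open Scope classical_set_scope.
Local Open Scope ring_scope.

(** * The norm of the conductor and the discriminant *)

Section NumberField.
Variable K : fieldExtType rat.
Local Notation n := (\dim {:K}).

Lemma rat_common_denom m (k : 'I_m -> rat) :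
  exists2 d : int, d != 0 & exists c : 'I_m -> int, forall i, d%:~R * k i = (c i)%:~R.
Proof.
exists (\prod_(i < m) denq (k i)).
  by apply/prodf_neq0 => i _; rewrite denq_eq0.
exists (fun i => (\prod_(j < m | j != i) denq (k j)) * numq (k i)) => i.
by rewrite (bigD1 i)//= !intrM numqE; ring.
Qed.

(** More vectors than the dimension are linearly dependent over the rationals, and a common
    denominator makes the coefficients integral. *)
Lemma int_relation (f : 'I_n.+1 -> K) :
  exists c : 'I_n.+1 -> int,
    (exists i, c i != 0) /\ \sum_(i < n.+1) (c i)%:~R * f i = 0.
Proof.
have nfree : ~~ free [tuple f i | i < n.+1].
  apply/negP => fr; have := dimvS (subvf <<[tuple f i | i < n.+1]>>%VS).
  by move: fr => /eqP ->; rewrite size_tuple ltnn.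
have [k [sk [i0 ki0]]] : exists k : 'I_n.+1 -> rat,
    \sum_(i < n.+1) k i *: f i = 0 /\ exists i, k i != 0.
  apply: contrapT => nk; move/negP: nfree; apply; apply/freeP => k sk i.
  apply: contrapT => /eqP ki; apply: nk; exists k; split; last by exists i.
  by rewrite -[RHS]sk; apply: eq_bigr => j _; rewrite nth_mktuple.
have [d d0 [c dc]] := rat_common_denom k.
exists c; split.
  by exists i0; rewrite -(intr_eq0 rat) -dc mulf_neq0// intr_eq0.
transitivity (d%:~R *: (\sum_(i < n.+1) k i *: f i)); last by rewrite sk scaler0.
rewrite scaler_sumr; apply: eq_bigr => i _.
by rewrite scalerA dc -mulr_algl scaler_int.
Qed.

(** As K has characteristic 0, a relation whose coefficients are all divisible by p can be divided
    by p. This cannot go on forever, since a nonzero coefficient shrinks each time. *)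
Lemma int_relation_mod (p : nat) (f : 'I_n.+1 -> K) : (1 < p)%N ->
  exists c : 'I_n.+1 -> int,
    (exists i, ~~ (p%:Z %| c i)%Z) /\ \sum_(i < n.+1) (c i)%:~R * f i = 0.
Proof.
move=> p1; have [c [[i ci] sc]] := int_relation f.
(* The index [i] of a nonzero coefficient stays fixed; the descent is on the absolute value of
   [c i]. *)
have [m] := ubnP `|c i|%N; elim: m => // m IH in c ci sc *; rewrite ltnS => cm.
have [/forallP/= pc|] := boolP [forall j, (p%:Z %| c j)%Z]; last first.
  by rewrite negb_forall => /existsP[j cj]; exists c; split => //; exists j.
pose c' j := (c j %/ p%:Z)%Z.
have cc' j : c j = c' j * p%:Z by rewrite /c' divzK.
apply: (IH c').
- by apply: contraNneq ci => c'0; rewrite cc' c'0 mul0r.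
- have /eqP : p%:~R * \sum_(j < n.+1) (c' j)%:~R * f j = 0.
    rewrite -[RHS]sc mulr_sumr; apply: eq_bigr => j _.
    by rewrite [c j]cc' intrM mulrA; congr (_ * _); rewrite mulrC.
  rewrite mulf_eq0 => /orP[|/eqP//].
  rewrite -(rmorph_int (in_alg K)) fmorph_eq0 intr_eq0.
  by move: p1; case: (p).
- apply: leq_trans cm; rewrite [c i]cc' abszM /= ltn_Pmulr//.
  rewrite lt0n absz_eq0; apply: contraNneq ci => c'0; by rewrite cc' c'0 mul0r.
Qed.

End NumberField.
Lemma rmorph_int_comb (A B : pzRingType) (g : {rmorphism A -> B}) m
    (c : 'I_m -> int) (x : 'I_m -> A) :
  g (\sum_(i < m) (c i)%:~R * x i) = \sum_(i < m) (c i)%:~R * g (x i).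
Proof. by rewrite rmorph_sum; apply: eq_bigr => i _; rewrite rmorphM rmorph_int. Qed.


(** * Residue fields at the places of a number field *)

Section PlaceOfNumberField.
Local Open Scope quotient_scope.
Variables (K : fieldExtType rat) (v : place K).
Local Notation n := (\dim {:K}).

Lemma vge_nat m : vge v 0 m%:R.
Proof.
elim: m => [|m IH]; first by rewrite /vge eqxx.
by rewrite mulrSr; apply: vgeD => //; rewrite /vge pval1 lexx orbT.
Qed.

Lemma vge_int (z : int) : vge v 0 z%:~R.
Proof. by case: z => m; rewrite ?NegzE ?mulrNz ?vgeN; apply: vge_nat. Qed.

Lemma vge_sum (I : finType) (P : pred I) (F : I -> K) (m : int) :
  (forall i, P i -> vge v m (F i)) -> vge v m (\sum_(i | P i) F i).
Proof.
move=> PF; elim/big_rec: _ => [|i x Pi xm]; first by rewrite /vge eqxx.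
by apply: vgeD => //; apply: PF.
Qed.

Lemma intr_numfield_eq0 (z : int) : (z%:~R == 0 :> K) = (z == 0).
Proof. by rewrite -(rmorph_int (in_alg K)) fmorph_eq0 intr_eq0. Qed.

Lemma natr_numfield_eq0 (m : nat) : (m%:R == 0 :> K) = (m == 0)%N.
Proof. exact: (intr_numfield_eq0 m). Qed.

Lemma pvalX x i : x != 0 -> v (x ^+ i) = v x * i%:Z.
Proof.
move=> x0; elim: i => [|i IH]; first by rewrite expr0 pval1 mulr0.
by rewrite exprS pvalM ?expf_neq0// IH intS mulrDr mulr1.
Qed.

(* If v were trivial on the integers, the nonzero terms of an integer relation
   between powers of a uniformizer would have distinct valuations. *)
Lemma place_nontrivial_int : exists m : nat, (m != 0)%N && (0 < v m%:R).
Proof.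
apply: contrapT => nv.
have vint0 (z : int) : z != 0 -> v z%:~R = 0.
  move=> z0; suff vn (m : nat) : (m != 0)%N -> v m%:R = 0.
    by case: z z0 => m m0; rewrite ?NegzE ?mulrNz ?pvalN vn.
  move=> m0; apply/le_anti/andP; split.
    by rewrite leNgt; apply/negP => vm; apply: nv; exists m; rewrite m0.
  by have := vge_nat m; rewrite /vge natr_numfield_eq0 (negPf m0).
have [x x0 vx] := pval_surj v.
have [c [[i0 ci0] sc]] := int_relation (fun i : 'I_n.+1 => x ^+ i).
case: (@arg_minnP _ i0 (fun i => c i != 0) (@nat_of_ord _) ci0) => i ci imin.
have cx0 : (c i)%:~R * x ^+ i != 0 by rewrite mulf_neq0 ?intr_numfield_eq0 ?expf_neq0.
have vcx : v ((c i)%:~R * x ^+ i) = i.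
  by rewrite pvalM ?intr_numfield_eq0 ?expf_neq0// vint0// pvalX// vx mul1r add0r.
have : vge v i.+1%:Z ((c i)%:~R * x ^+ i).
  move: sc; rewrite (bigD1 i)//= => /eqP; rewrite addr_eq0 => /eqP ->.
  rewrite vgeN; apply: vge_sum => j ji.
  have [->|cj] := eqVneq (c j) 0; first by rewrite mul0r /vge eqxx.
  rewrite -[i.+1%:Z]add0r; apply: vgeM; first exact: vge_int.
  rewrite /vge pvalX// vx mul1r lez_nat ltn_neqAle imin// andbT.
  by apply/orP; right; rewrite eq_sym (inj_eq val_inj).
by rewrite /vge (negPf cx0) vcx /= lez_nat ltnn.
Qed.

(** A nonzero integer of positive valuation maps to 0 in the residue field, which therefore has
    positive characteristic. *)
Lemma residue_char : exists p : nat, p \in [pchar (residue v)].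
Proof.
have [m /andP[m0 vm]] := place_nontrivial_int.
apply: (@natf0_pchar _ m); first by rewrite lt0n.
rewrite -(rmorph_nat \pi_(residue v)) -[eqbRHS](rmorph0 \pi_(residue v)).
rewrite -Quotient.idealrBE subr0 unfold_in /vmax.
have -> : vval (m%:R : valring v) = m%:R by exact: (rmorph_nat (\val : valring v -> K)).
by rewrite /vge -gtz0_ge1 vm orbT.
Qed.

(** Lift the elements to the valuation ring, take a relation there with a coefficient prime to p,
    and reduce it: that coefficient survives. This bounds the dimension of the residue field over
    its prime field. *)
Lemma residue_relation (f : 'I_n.+1 -> residue v) :
  exists c : 'I_n.+1 -> int,
    (exists i, (c i)%:~R != 0 :> residue v) /\ \sum_(i < n.+1) (c i)%:~R * f i = 0.
Proof.
have [p pv] := residue_char; have p1 := prime_gt1 (pcharf_prime pv).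
have [c [[i ci] sc]] := int_relation_mod (fun i => vval (repr (f i))) p1.
exists c; split.
  exists i; apply: contra ci.
  have cabs : (c i)%:~R = (-1) ^+ (c i < 0)%R * (`|c i|%N)%:R :> residue v.
    by rewrite {1}[c i]intEsign rmorphM rmorph_sign.
  by rewrite cabs mulf_eq0 signr_eq0 /= -(dvdn_pcharf pv).
have sc' : \sum_(i < n.+1) (c i)%:~R * repr (f i) = 0 :> valring v.
  by apply: val_inj; rewrite (rmorph_int_comb (\val : valring v -> K)).
have -> : f = \pi_(residue v) \o (fun i => repr (f i)).
  by apply/funext => j; rewrite /= reprK.
transitivity (\pi_(residue v) (\sum_(i < n.+1) (c i)%:~R * repr (f i))).
  exact/esym/(rmorph_int_comb \pi_(residue v)).
by rewrite sc' rmorph0.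
Qed.

End PlaceOfNumberField.

(** * Finiteness of a field of bounded dimension over its prime field *)

Lemma pchar_int_modn (F : fieldType) (p : nat) (c : int) : p \in [pchar F] ->
  exists2 m : nat, (m < p)%N & c%:~R = m%:R :> F.
Proof.
move=> pF; have p0 := prime_gt0 (pcharf_prime pF).
have p0' : p%:Z != 0 by rewrite eqz_nat -lt0n.
exists `|(c %% p%:Z)%Z|%N.
  by rewrite -ltz_nat gez0_abs ?modz_ge0// ltz_pmod.
rewrite {1}(divz_eq c p) intrD intrM [p%:~R](pcharf0 pF) mulr0 add0r.
by rewrite -{1}[(c %% p)%Z]gez0_abs ?modz_ge0.
Qed.

(** Linear independence over the prime field is expressed with integer scalars. An independent
    family of maximal size spans the field, and only finitely many scalars occur. *)
Lemma finite_int_relations (F : fieldType) (p N : nat) : p \in [pchar F] ->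
  (forall f : 'I_N -> F, exists c : 'I_N -> int,
    (exists i, (c i)%:~R != 0 :> F) /\ \sum_(i < N) (c i)%:~R * f i = 0) ->
  finite_set [set: F].
Proof.
move=> pF dep; have p0 := prime_gt0 (pcharf_prime pF).
pose indep k := exists f : 'I_k -> F, forall c : 'I_k -> int,
  \sum_(i < k) (c i)%:~R * f i = 0 -> forall i, (c i)%:~R = 0 :> F.
have ind0 : exists k, `[< indep k >].
  by exists 0%N; apply/asboolP; exists (fun=> 0) => c _ [].
have indle k : `[< indep k >] -> (k <= N)%N.
  move=> /asboolP[f fi]; rewrite leqNgt; apply/negP => Nk.
  have kE := subnKC (ltnW Nk); rewrite -{}kE in f fi.
  have [c [[i ci] sc]] := dep (f \o lshift _).
  (* A relation among the first N members, extended by zero, contradicts the independence of a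
     longer family. *)
  pose c' (j : 'I_(N + (k - N))) := if fintype.split j is inl i then c i else 0.
  have c'l j : c' (lshift _ j) = c j by rewrite /c' (unsplitK (inl j)).
  have c'r j : c' (rshift _ j) = 0 by rewrite /c' (unsplitK (inr j)).
  have /fi/(_ (lshift _ i)) : \sum_j (c' j)%:~R * f j = 0.
    rewrite big_split_ord /= [X in _ + X]big1 => [|j _]; last by rewrite c'r mul0r.
    by rewrite addr0 -[RHS]sc; apply: eq_bigr => j _; rewrite c'l.
  by rewrite c'l => /eqP; rewrite (negPf ci).
have [k /asboolP[f fi] kmax] := ex_maxnP ind0 indle.
(* This is the solution y of c_0 y + c_1 f_0 + ... + c_k f_(k-1) = 0, with coefficients reduced
   modulo p. An element outside the image of [g] would extend the maximal family. *)
pose g (c : {ffun 'I_k.+1 -> 'I_p}) : F :=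
  - (c ord0)%:R^-1 * \sum_(i < k) (c (lift ord0 i))%:R * f i.
apply: (@sub_finite_set _ _ (g @` setT)); last first.
  by apply: finite_image; apply: finite_finset.
move=> y _; apply: contrapT => yg.
suff : `[< indep k.+1 >] by move/kmax; rewrite ltnn.
apply/asboolP; exists (fun i => if unlift ord0 i is Some j then f j else y).
move=> c; rewrite big_ord_recl unlift_none.
under eq_bigr do rewrite liftK.
move=> sc; have [c0|c0] := eqVneq ((c ord0)%:~R : F) 0.
  move: sc; rewrite c0 mul0r add0r => /fi c1 i.
  by case: (unliftP ord0 i) => [j|] ->.
exfalso; apply: yg.
have cm i : exists m : 'I_p, (c i)%:~R = m%:R :> F.
  by have [m mp ->] := pchar_int_modn (c i) pF; exists (Ordinal mp).
have [m mE] := choice cm.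
exists [ffun i => m i] => //; rewrite /g ffunE.
under eq_bigr do rewrite ffunE -mE.
move/eqP: sc; rewrite addrC addr_eq0 -mE => /eqP ->.
by rewrite mulrNN mulKf.
Qed.

Section ConductorNorm.
Variable K : fieldExtType rat.

(** [fset_set] sends an infinite set to the empty one, so [qv v] would be 0 if the residue field
    were infinite: positivity amounts to finiteness. *)
Lemma qv_gt0 (v : place K) : (0 < qv v)%N.
Proof.
have [p pv] := residue_char v.
have fin := finite_int_relations pv (@residue_relation K v).
rewrite /qv /card_set lt0n finmap.cardfs_eq0; apply/negP => /eqP.
move=> /(fset_set_set0 fin) e.
by have : [set: residue v] 0 by []; rewrite e.
Qed.

Lemma cond_norm_gt0 (E : weier K) : (0 < cond_norm E)%N.
Proof.
rewrite /cond_norm; elim/big_rec: _ => // v m _ m0.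
by rewrite muln_gt0 expn_gt0 qv_gt0.
Qed.

End ConductorNorm.

(** * Nonvanishing of the discriminant *)

Section Discriminant.
Variable K : fieldExtType rat.
Local Notation n := (\dim {:K}).

(** If d y^m + c_(m-1) y^(m-1) + ... + c_0 = 0 with d nonzero, multiplying by d^(m-1) gives a monic
    integral equation for d y. *)
Lemma integral_multiple (y : K) :
  exists2 d : int, d != 0 & integralOver (intr : int -> K) (d%:~R * y).
Proof.
have [c [[i0 ci0] sc]] := int_relation (fun i : 'I_n.+1 => y ^+ i).
case: (@arg_maxnP _ i0 (fun i => c i != 0) (@nat_of_ord _) ci0) => m cm mmax.
pose c' (k : nat) := c (inord k).
have {sc} sc : \sum_(k < m.+1) (c' k)%:~R * y ^+ k = 0.
  rewrite (big_ord_widen n.+1 (fun k : nat => (c' k)%:~R * y ^+ k)) ?ltn_ord//.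
  rewrite -[RHS]sc [RHS](bigID (fun i : 'I_n.+1 => (i < m.+1)%N))/=.
  rewrite [X in _ = _ + X]big1 ?addr0 => [|i im].
    by apply: eq_bigr => i _; rewrite /c' inord_val.
  have [->|/mmax] := eqVneq (c i) 0; first by rewrite mul0r.
  by move: im; rewrite -leqNgt => mi /(leq_trans mi); rewrite ltnn.
rewrite big_ord_recr /= addrC {1}/c' inord_val in sc.
(* Were m zero, the relation would read c_0 = 0 with c_0 the nonzero leading coefficient. *)
have m0 : (0 < m)%N.
  rewrite lt0n; apply: contraNneq cm => m0; move: sc.
  by rewrite m0 big_ord0 expr0 mulr1 addr0 => /eqP; rewrite intr_numfield_eq0.
exists (c m) => //; set d := c m.
exists ('X^m + \poly_(k < m) (c' k * d ^+ (m.-1 - k))).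
  by rewrite monicE lead_coefDl ?lead_coefXn// size_polyXn ltnS size_poly.
apply/rootP; rewrite rmorphD /= map_polyXn hornerD hornerXn.
rewrite (_ : map_poly _ _ = \poly_(k < m) ((c' k)%:~R * d%:~R ^+ (m.-1 - k))); last first.
  apply/polyP => i; rewrite coef_map !coef_poly.
  by case: ifP => // _; rewrite /= intrM (rmorphXn (intr : {rmorphism int -> K})).
rewrite horner_poly.
apply: (@etrans _ _ (d%:~R ^+ m.-1 * (d%:~R * y ^+ m + \sum_(k < m) (c' k)%:~R * y ^+ k))).
2: by rewrite sc mulr0.
rewrite mulrDr mulr_sumr; congr (_ + _).
  by rewrite exprMn mulrA -exprSr prednK.
apply: eq_bigr => i _; have im : (i <= m.-1)%N by rewrite -ltnS prednK.
by rewrite -[in RHS](subnK im) exprMn exprD; ring.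
Qed.

Lemma field_trace_lin m (a : 'I_m -> rat) (x : 'I_m -> K) :
  field_trace (\sum_(i < m) a i *: x i) = \sum_(i < m) a i * field_trace (x i).
Proof.
rewrite /field_trace; under [RHS]eq_bigr do rewrite mulr_sumr.
rewrite exchange_big; apply: eq_bigr => i _.
rewrite mulr_suml linear_sum; apply: eq_bigr => j _.
by rewrite -scalerAl linearZ.
Qed.

Lemma field_trace1 : field_trace (1 : K) = n%:R.
Proof.
rewrite /field_trace -[n in RHS]card_ord -sumr_const; apply: eq_bigr => i _.
by rewrite mul1r coord_free ?eqxx// (basis_free (vbasisP _)).
Qed.

(** Every element has a nonzero integer multiple in the integral span of b, so b spans K over the
    rationals; it has as many members as the dimension. *)
Lemma integral_basis_free (b : n.-tuple K) : integral_basis b -> basis_of {:K} b.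
Proof.
move=> [_ bP]; rewrite basisEdim size_tuple leqnn andbT.
apply/subvP => y _; have [d d0 /bP[c [dy _]]] := integral_multiple y.
have -> : y = d%:~R^-1 *: (d%:~R * y).
  rewrite -[d%:~R * y]/(1 *~ d * y) -scaler_int mulr_algl scalerA mulVf ?scale1r//.
  by rewrite intr_eq0.
rewrite dy; apply: memvZ; apply: memv_suml => i _.
rewrite -(rmorph_int (in_alg K)) /= mulr_algl; apply: memvZ.
by apply: memv_span; apply: mem_nth; rewrite size_tuple.
Qed.

(** A kernel vector of the Gram matrix yields a nonzero x whose product with every element has trace
    0. Yet x x^-1 = 1 has trace n, which is nonzero in characteristic 0. *)
Lemma disc_neq0 : disc K != 0.
Proof.
(* The second case is the default value 1 of [xget]. *)
rewrite /disc; case: xgetP => [d _ [b bi ->]|_]; last exact: oner_neq0.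
have bb := integral_basis_free bi.
apply/negP => /det0P[u u0 uM].
pose x := \sum_(i < n) u ord0 i *: b`_i.
have trx j : field_trace (x * b`_(j : 'I_n)) = 0.
  have /matrixP/(_ ord0 j) := uM; rewrite !mxE => <-.
  rewrite /x mulr_suml; under eq_bigr do rewrite -scalerAl.
  by rewrite field_trace_lin; apply: eq_bigr => i _; rewrite mxE.
have x0 : x != 0.
  apply: contraNneq u0 => x0; apply/eqP/rowP => i; rewrite mxE.
  by have /freeP/(_ _ x0) -> := basis_free bb.
have : field_trace (x * x^-1) = 0.
  rewrite [x^-1](coord_basis bb (memvf _)) mulr_sumr.
  under eq_bigr do rewrite -scalerAr.
  by rewrite field_trace_lin big1// => i _; rewrite trx mulr0.
rewrite divff// field_trace1 => /eqP; rewrite pnatr_eq0.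
by have := adim_gt0 {:K}%AS; rewrite lt0n => /negPf ->.
Qed.

End Discriminant.

(** * The Gamma function near 1 *)

Section RealGamma.
Variable R : realType.
Implicit Types (h u : R) (n : nat).

Lemma subr_ln1Dx_ge0 u : -1 < u -> 0 <= u - ln (1 + u).
Proof. by move=> u1; rewrite subr_ge0 le_ln1Dx. Qed.

(** Applying ln (1 + z) <= z to 1 + z = 1 / (1 + u) bounds the left side by u^2 / (1 + u), and 1 + u
    >= 1/2. *)
Lemma subr_ln1Dx_le u : - 2^-1 <= u -> u - ln (1 + u) <= 2 * u ^+ 2.
Proof.
move=> u2; have u1 : 0 < 1 + u by lra.
have : ln (1 + - (u / (1 + u))) <= - (u / (1 + u)).
  apply: le_ln1Dx; rewrite ltrN2 ltr_pdivrMr//; lra.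
have -> : 1 + - (u / (1 + u)) = (1 + u)^-1 by field; lra.
rewrite lnV ?posrE// => lnu; apply: (@le_trans _ _ (u - u / (1 + u))); first by lra.
have -> : u - u / (1 + u) = u ^+ 2 / (1 + u) by field; lra.
rewrite ler_pdivrMr//; nra.
Qed.

(* the partial sums of log Gamma(1 + h) + gamma h *)
Definition lnGamma_sum h n : R := \sum_(1 <= k < n.+1) (h / k%:R - ln (1 + h / k%:R)).

(** Since 1 / (x + 1)^2 <= 1 / x - 1 / (x + 1), the sum telescopes to at most 2 - 1/n. *)
Lemma sum_inv_sqr_le n : \sum_(1 <= k < n.+1) (k%:R ^+ 2)^-1 <= 2 :> R.
Proof.
case: n => [|n]; first by rewrite big_geq.
suff : \sum_(1 <= k < n.+2) (k%:R ^+ 2)^-1 <= 2 - n.+1%:R^-1 :> R.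
  by move/le_trans; apply; rewrite lerBlDr lerDl invr_ge0.
elim: n => [|n IH]; first by rewrite big_nat1 expr1n invr1; lra.
rewrite big_nat_recr//= (le_trans (lerD IH (lexx _)))//.
have n1 : 0 < n.+1%:R :> R by rewrite ltr0n.
rewrite -[n.+2%:R]natr1 -subr_ge0; move: n.+1%:R n1 => x x0.
have -> : 2 - (x + 1)^-1 - (2 - x^-1 + ((x + 1) ^+ 2)^-1) = (x * (x + 1) ^+ 2)^-1.
  by field; apply/andP; split; lra.
by rewrite invr_ge0 mulr_ge0 ?exprn_ge0//; lra.
Qed.

Lemma div_nat_bounds h k : - 2^-1 <= h -> (0 < k)%N -> - 2^-1 <= h / k%:R.
Proof.
move=> h2 k0; have k1 : 1 <= k%:R :> R by rewrite ler1n.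
rewrite ler_pdivlMr ?ltr0n//; nra.
Qed.

Lemma lnGamma_sum_ge0 h n : - 2^-1 <= h -> 0 <= lnGamma_sum h n.
Proof.
move=> h2; rewrite /lnGamma_sum big_nat_cond sumr_ge0// => k /andP[/andP[k0 _] _].
by apply/subr_ln1Dx_ge0/(lt_le_trans _ (div_nat_bounds h2 k0)); lra.
Qed.

Lemma lnGamma_sum_le h n : - 2^-1 <= h -> lnGamma_sum h n <= 4 * h ^+ 2.
Proof.
move=> h2; apply: (@le_trans _ _ (\sum_(1 <= k < n.+1) 2 * h ^+ 2 * (k%:R ^+ 2)^-1)).
  apply: ler_sum_nat => k /andP[k0 _].
  by rewrite (le_trans (subr_ln1Dx_le (div_nat_bounds h2 k0)))// expr_div_n mulrA.
rewrite -mulr_sumr; have := sum_inv_sqr_le n; have := sqr_ge0 h; nra.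
Qed.

(** The terms are nonnegative and the partial sums bounded. The quadratic bound on the limit is the
    O(h^2) error in log Gamma (1 + h). *)
Lemma lnGamma_sum_cvg h : - 2^-1 <= h ->
  exists2 S, lnGamma_sum h @ \oo --> S & 0 <= S <= 4 * h ^+ 2.
Proof.
move=> h2; have c : cvgn (lnGamma_sum h).
  apply: nondecreasing_is_cvgn; last first.
    by exists (4 * h ^+ 2) => _ [n _ <-]; apply: lnGamma_sum_le.
  apply/nondecreasing_seqP => n; rewrite /lnGamma_sum [leRHS]big_nat_recr//= lerDl.
  by apply/subr_ln1Dx_ge0/(lt_le_trans _ (div_nat_bounds h2 (ltn0Sn n))); lra.
exists (limn (lnGamma_sum h)) => //; apply/andP; split.
  by apply: limr_ge => //; near=> n; exact: lnGamma_sum_ge0.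
by apply: limr_le => //; near=> n; exact: lnGamma_sum_le.
Unshelve. all: by end_near. Qed.

Definition harmonic_sub_ln n : R := \sum_(1 <= k < n.+1) k%:R^-1 - ln n%:R.

Lemma sum_ln1Dinv n : \sum_(1 <= k < n.+1) ln (1 + 1 / k%:R) = ln n.+1%:R :> R.
Proof.
elim: n => [|n IH]; first by rewrite big_geq// ln1.
have n1 : 0 < n.+1%:R :> R by rewrite ltr0n.
have n1' : 0 < 1 + 1 / n.+1%:R :> R by rewrite addr_gt0// divr_gt0.
rewrite big_nat_recr//= IH -lnM ?posrE//.
by congr ln; rewrite -[n.+2%:R]natr1; field; lra.
Qed.

(** At h = 1 the logarithms in [lnGamma_sum] telescope to ln (n + 1), so convergence to Euler's
    constant is a case of the convergence of [lnGamma_sum]. *)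
Lemma harmonic_sub_lnE n : (0 < n)%N ->
  harmonic_sub_ln n = lnGamma_sum 1 n + ln (1 + n%:R^-1).
Proof.
move=> n0; have n0' : 0 < n%:R :> R by rewrite ltr0n.
rewrite /harmonic_sub_ln /lnGamma_sum sumrB sum_ln1Dinv.
under [in RHS]eq_bigr do rewrite div1r.
have -> : n.+1%:R = n%:R * (1 + n%:R^-1) :> R.
  by rewrite -natr1; field; lra.
by rewrite lnM ?posrE ?addr_gt0 ?invr_gt0//; ring.
Qed.

Lemma cvg_invn : (fun n => n%:R^-1 : R) @ \oo --> 0.
Proof. by rewrite -cvg_shiftS; exact: cvg_harmonic. Qed.

Lemma euler_gamma_cvg : harmonic_sub_ln @ \oo --> euler_gamma R.
Proof.
suff : cvgn harmonic_sub_ln by [].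
have [S cS _] : exists2 S, lnGamma_sum 1 @ \oo --> S & 0 <= S <= 4 * 1 ^+ 2.
  by apply: lnGamma_sum_cvg; lra.
apply: (cvgP (S + ln (1 + 0))).
apply: cvg_trans (_ : lnGamma_sum 1 n + ln (1 + n%:R^-1) @[n --> \oo] --> _).
  apply: near_eq_cvg; near=> n; apply/esym/harmonic_sub_lnE; near: n.
  exact: nbhs_infty_gt.
apply: cvgD => //; apply: continuous_cvg.
  by apply: continuous_ln; rewrite addr0.
by apply: cvgD; [exact: cvg_cst|exact: cvg_invn].
Unshelve. all: by end_near. Qed.

(** The factors are h + 1, ..., h + n + 1. Pulling k out of h + k for k <= n produces the factorial;
    the last factor stays apart. *)
Lemma prod_shift h n : - 2^-1 <= h ->
  \prod_(k < n.+1) (1 + h + k%:R) =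
  n`!%:R * expR (\sum_(1 <= k < n.+1) ln (1 + h / k%:R)) * (n.+1%:R + h).
Proof.
move=> h2; elim: n => [|n IH].
  by rewrite big_ord1 big_geq// expR0 fact0 !mul1r addr0.
have n1 : 0 < n.+1%:R :> R by rewrite ltr0n.
rewrite big_ord_recr /= IH [in RHS]big_nat_recr//= expRD lnK; last first.
  rewrite posrE -ltrBlDl sub0r.
  by apply: (lt_le_trans _ (div_nat_bounds h2 (ltn0Sn n))); lra.
rewrite factS natrM -[n.+2%:R]natr1; field; lra.
Qed.

Definition Gamma_approx h n : R :=
  n`!%:R * expR ((1 + h) * ln n%:R) / \prod_(k < n.+1) (1 + h + k%:R).

(** With H the harmonic sum and A the sum of the ln (1 + h/k), the exponent h ln n - A is regrouped
    as (h H - A) - h (H - ln n), where both brackets converge. The denominator is (n + 1 + h) /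
    n. *)
Lemma Gamma_approxE h n : - 2^-1 <= h -> (0 < n)%N ->
  Gamma_approx h n =
  expR (lnGamma_sum h n - h * harmonic_sub_ln n) / (1 + (1 + h) * n%:R^-1).
Proof.
move=> h2 n0; have n0' : 0 < n%:R :> R by rewrite ltr0n.
have f0 : n`!%:R != 0 :> R by rewrite pnatr_eq0 -lt0n fact_gt0.
rewrite /Gamma_approx prod_shift// /lnGamma_sum /harmonic_sub_ln sumrB -mulr_sumr.
set H := \sum_(_ <= _ < _) _^-1; set A := \sum_(_ <= _ < _) _.
have -> : h * H - A - h * (H - ln n%:R) = h * ln n%:R - A by ring.
rewrite mulrDl mul1r expRD lnK ?posrE// expRB -[n.+1%:R]natr1.
have := expR_gt0 A; set e := expR A => e0.
have ? : n%:R + (1 + h) != 0 by apply: lt0r_neq0; lra.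
by field; repeat (apply/andP; split) => //; apply: lt0r_neq0; lra.
Qed.

Lemma Gamma_approx_cvg h : - 2^-1 <= h -> exists2 S,
  Gamma_approx h @ \oo --> expR (S - h * euler_gamma R) & 0 <= S <= 4 * h ^+ 2.
Proof.
move=> h2; have [S cS Sb] := lnGamma_sum_cvg h2; exists S => //.
rewrite -[expR _]divr1 -[X in _ / X](addr0 1) -[X in _ / (1 + X)](mulr0 (1 + h)).
apply: cvg_trans (_ : expR (lnGamma_sum h n - h * harmonic_sub_ln n) /
   (1 + (1 + h) * n%:R^-1) @[n --> \oo] --> _).
  apply: near_eq_cvg; near=> n; apply/esym/Gamma_approxE => //; near: n.
  exact: nbhs_infty_gt.
apply: cvgM; last first.
  apply: cvgV; first by rewrite mulr0 addr0.
  by apply: cvgD; [exact: cvg_cst|apply: cvgM; [exact: cvg_cst|exact: cvg_invn]].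
apply: continuous_cvg; first exact: continuous_expR.
apply: cvgB => //; apply: cvgM; [exact: cvg_cst|exact: euler_gamma_cvg].
Unshelve. all: by end_near. Qed.

End RealGamma.

(** * The complex Gamma function at real points *)

Section ComplexEmbedding.
Variable R : realType.
Implicit Types (x h t : R).
Local Notation toC := (real_complex R : R -> cplx R).

Lemma norm_toC x : `|toC x| = toC `|x|.
Proof. by rewrite [LHS]normc_def /= expr0n addr0 sqrtr_sqr. Qed.

Lemma cvg_toC (u : R ^nat) x : u @ \oo --> x -> (fun n => toC (u n)) @ \oo --> toC x.
Proof.
move=> ux; apply/cvgrPdist_lt => e e0.
(* Norms on [cplx R] take values in [cplx R] itself; a positive radius there is real. *)
have eE : e = toC (complex.Re e) by apply/esym/RRe_real/gtr0_real.
have re0 : 0 < complex.Re e by move: e0; rewrite {1}eE ltcR.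
have /cvgrPdist_lt/(_ _ re0) := ux; apply: filterS => n.
by rewrite eE -raddfB norm_toC ltcR.
Qed.

Lemma cpow_toC x t : cpow x (toC t) = toC (expR (t * ln x)).
Proof. by rewrite /cpow /= mul0r cos0 sin0 mulr1 mulr0. Qed.

Lemma cGamma_near1 h : - 2^-1 <= h -> exists2 S,
  cGamma (1 + toC h) = toC (expR (S - h * euler_gamma R)) & 0 <= S <= 4 * h ^+ 2.
Proof.
move=> h2; have [S cS Sb] := Gamma_approx_cvg h2; exists S => //.
have hE : 1 + toC h = toC (1 + h) by rewrite rmorphD rmorph1.
apply: cvg_lim => //.
rewrite (_ : (fun n : nat => _) = fun n => toC (Gamma_approx h n)); first exact: cvg_toC.
apply/funext => n.
rewrite /Gamma_approx hE cpow_toC rmorphM rmorphM rmorph_nat fmorphV rmorph_prod.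
congr (_ * _ * _^-1); apply: eq_bigr => i _.
by rewrite [RHS]rmorphD [in RHS]rmorph_nat.
Qed.

End ComplexEmbedding.

(** * Leading coefficients and the functional equation *)

(** Convergence at one h0 > 0 bounds |a_k| h0^k by some B. For |h| < h0 / 2 the tail from index m on
    is then dominated by a geometric series of ratio q = |h| / h0 <= 1/2, whose sum is at most 2. *)
Lemma power_series_tail (K : numFieldType) (f : K -> K) (a : nat -> K) (m : nat) :
  (\forall h \near (0 : K), series (fun k => a k * h ^+ k) @ \oo --> f h) ->
  exists M : K, \forall h \near (0 : K),
    `|f h - \sum_(k < m) a k * h ^+ k| <= M * `|h| ^+ m.
Proof.
move=> af; have [d /= d0 df] := af.
pose h0 := d / 2; have h00 : 0 < h0 by rewrite divr_gt0.
have h0d : h0 < d by rewrite ltr_pdivrMr// ltr_pMr// ltr1n.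
have ch0 : series (fun k => a k * h0 ^+ k) @ \oo --> f h0.
  by apply: df; rewrite /= sub0r normrN gtr0_norm.
have [B B0 aB] : exists2 B, 0 <= B & forall k, `|a k| * h0 ^+ k <= B.
  have /cvgrPdist_lt/(_ _ ltr01) [N _ aN] := cvg_series_cvg_0 (cvgP _ ch0).
  exists (1 + \sum_(k < N) `|a k| * h0 ^+ k).
    by rewrite addr_ge0// sumr_ge0// => k _; rewrite mulr_ge0// exprn_ge0// ltW.
  move=> k; have [Nk|kN] := leqP N k.
    have := aN _ Nk; rewrite /= sub0r normrN normrM normrX (gtr0_norm h00) => /ltW ak.
    rewrite (le_trans ak)// lerDl sumr_ge0// => i _.
    by rewrite mulr_ge0// exprn_ge0// ltW.
  rewrite (bigD1 (Ordinal kN))//= addrCA lerDl addr_ge0// sumr_ge0// => i _.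
  by rewrite mulr_ge0// exprn_ge0// ltW.
exists (B * 2 / h0 ^+ m).
exists (h0 / 2); first by rewrite /= divr_gt0.
move=> h /=; rewrite sub0r normrN => hh0.
have hd : `|h| < d.
  by apply: lt_trans hh0 (lt_trans _ h0d); rewrite ltr_pdivrMr// ltr_pMr// ltr1n.
have ch : series (fun k => a k * h ^+ k) @ \oo --> f h.
  by apply: df; rewrite /= sub0r normrN.
pose q := `|h| / h0.
have q0 : 0 <= q by rewrite divr_ge0// ltW.
have q2 : q <= 2^-1 by rewrite ler_pdivrMr// mulrC ltW.
have geo j : \sum_(i < j) q ^+ i <= 2.
  have q1 : 2^-1 <= 1 - q by rewrite lerBrDl -lerBrDr (_ : 1 - 2^-1 = 2^-1)//; field.
  have : 2^-1 * (\sum_(i < j) q ^+ i) <= 1.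
    apply: (@le_trans _ _ ((1 - q) * \sum_(i < j) q ^+ i)).
      by rewrite ler_wpM2r// sumr_ge0// => i _; rewrite exprn_ge0.
    by rewrite -opprB mulNr -subrX1 opprB gerBl exprn_ge0.
  by rewrite mulrC ler_pdivrMr// mul1r.
apply/ler_addgt0Pr => e e0.
have /cvgrPdist_lt/(_ _ e0) [N _ cN] := ch.
(* The length m + N puts the partial sum within e of [f h] and makes it contain the first m
   terms. *)
have := cN (m + N)%N (leq_addl _ _); set s := series _ _ => /= fs.
rewrite -[f h](subrK s) -addrA (le_trans (ler_normD _ _))// [leLHS]addrC.
apply: lerD; last exact: ltW.
have -> : s - \sum_(k < m) a k * h ^+ k = \sum_(i < N) a (m + i)%N * h ^+ (m + i).
  rewrite /s /series /= -(big_mkord xpredT (fun k => a k * h ^+ k)).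
  rewrite (big_cat_nat (n := m))//= ?leq_addr// [X in X - _]addrC addrK.
  by rewrite -{1}[m]add0n big_addn addKn big_mkord; apply: eq_bigr => i _; rewrite addnC.
apply: (@le_trans _ _ (\sum_(i < N) B * q ^+ m * q ^+ i)).
  apply: le_trans (ler_norm_sum _ _ _) _; apply: ler_sum => i _.
  rewrite normrM normrX -mulrA -exprD /q expr_div_n mulrA ler_pdivlMr ?exprn_gt0//.
  by rewrite mulrAC ler_wpM2r// exprn_ge0.
rewrite -mulr_sumr /q expr_div_n.
apply: (@le_trans _ _ (B * (`|h| ^+ m / h0 ^+ m) * 2)).
  by rewrite ler_wpM2l// mulr_ge0// divr_ge0// exprn_ge0// ltW.
by rewrite le_eqVlt; apply/orP; left; apply/eqP; ring.
Qed.

(** The inequality 1 + x <= exp x at x = h t and at -h t squeezes the quotient between t and t exp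
    (h t). *)
Lemma expR_quotient_cvg (R : realType) (h t : R ^nat) (c : R) :
  (forall n, 0 < h n) -> h @ \oo --> 0 -> t @ \oo --> c ->
  (fun n => (expR (h n * t n) - 1) / h n) @ \oo --> c.
Proof.
move=> h0 hc tc.
have c2 : (fun n => t n * expR (h n * t n)) @ \oo --> c.
  rewrite -[X in _ --> X]mulr1 -expR0 -(mul0r c); apply: cvgM => //.
  by apply: continuous_cvg; [exact: continuous_expR|exact: cvgM].
apply: (squeeze_cvgr _ tc c2); apply: nearW => n.
rewrite ler_pdivlMr// ler_pdivrMr// [t n * h n]mulrC; apply/andP; split.
  by rewrite lerBrDl; exact: expR_ge1Dx.
have := expR_ge1Dx (- (h n * t n)); have := expR_gt0 (h n * t n).
set x := h n * t n => ex0; rewrite expRN => le.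
have : (1 - x) * expR x <= 1 by rewrite -ler_pdivlMr// div1r.
by rewrite mulrAC [t n * h n]mulrC -/x; lra.
Qed.

Lemma cvg0_le_norm (K : numFieldType) (u v : nat -> K) :
  (\forall n \near \oo, `|u n| <= v n) -> v @ \oo --> 0 -> u @ \oo --> 0.
Proof.
move=> uv v0; apply/cvgrPdist_lt => e e0; move/cvgrPdist_lt/(_ _ e0): v0 => v0.
near=> n; rewrite sub0r normrN; apply: (@le_lt_trans _ _ (v n)); first by near: n.
apply: (@le_lt_trans _ _ `|0 - v n|); last by near: n.
(* The order on K is only partial; [v n] is real because it dominates a norm. *)
rewrite sub0r normrN real_ler_norm// ger0_real// (@le_trans _ _ `|u n|)//.
by near: n.
Unshelve. all: by end_near. Qed.

(** Here [Q] stands for F(h) / F(-h) along a sequence of points h tending to 0, and its first-order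
    behaviour 1 + 2 c h is given as the limit of a quotient. *)
Lemma reflection_leading_coefs (K : numFieldType) (l : K -> K) (r : nat)
    (a0 a1 c w M : K) (h Q : nat -> K) :
  (forall n, h n != 0) -> h @ \oo --> 0 ->
  (fun n => (Q n - 1) / (2 * h n)) @ \oo --> c ->
  (\forall s \near (0 : K), `|l s - (a0 * s ^+ r + a1 * s ^+ r.+1)| <= M * `|s| ^+ r.+2) ->
  (\forall n \near \oo, Q n * l (h n) = w * l (- h n)) ->
  a0 != 0 -> a1 = - c * a0.
Proof.
move=> h0 hc qc lb lQ a00.
(* Chosen so that l(s) = s^r (a0 + a1 s + s e(s)); the bound on l makes e(s) = O(s). *)
pose e (s : K) := (l s / s ^+ r - (a0 + a1 * s)) / s.
have le s : s != 0 -> l s = s ^+ r * (a0 + a1 * s + s * e s).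
  by move=> s0; rewrite /e; field; rewrite expf_neq0// s0.
have eb : \forall s \near (0 : K), s != 0 -> `|e s| <= M * `|s|.
  apply: filterS lb => s + s0; rewrite le//.
  have -> : s ^+ r * (a0 + a1 * s + s * e s) - (a0 * s ^+ r + a1 * s ^+ r.+1) =
     s ^+ r.+1 * e s by rewrite exprS; ring.
  rewrite normrM normrX [`|s| ^+ r.+2]exprSr mulrA [M * _]mulrC -mulrA.
  by rewrite ler_pM2l// exprn_gt0// normr_gt0.
have ec (u : nat -> K) : (forall n, u n != 0) -> u @ \oo --> 0 -> (e \o u) @ \oo --> 0.
  move=> u0 uc; apply: (@cvg0_le_norm _ _ (fun n => M * `|u n|)).
    have : \forall n \near \oo, u n != 0 -> `|e (u n)| <= M * `|u n| := uc _ eb.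
    by apply: filterS => n /(_ (u0 n)).
  rewrite -(mulr0 M); apply: cvgM; first exact: cvg_cst.
  by rewrite -(normr0 K); apply: cvg_norm.
have h0N n : - h n != 0 by rewrite oppr_eq0.
have hcN : (fun n => - h n) @ \oo --> 0 by rewrite -oppr0; apply: cvgN.
pose g (u : nat -> K) n := a0 + a1 * u n + u n * e (u n).
have gc (u : nat -> K) : (forall n, u n != 0) -> u @ \oo --> 0 -> g u @ \oo --> a0.
  move=> u0 uc; suff : g u @ \oo --> a0 + a1 * 0 + 0 * 0 by rewrite mulr0 mul0r !addr0.
  apply: cvgD; last by apply: cvgM => //; exact: ec.
  by apply: cvgD; [exact: cvg_cst|apply: cvgM => //; exact: cvg_cst].
(* Dividing by h^r leaves the sign (-1)^r from (-h)^r. *)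
have gQ : \forall n \near \oo, Q n * g h n = w * (-1) ^+ r * g (fun n => - h n) n.
  apply: filterS lQ => n; rewrite !le// => lQ.
  have hr : h n ^+ r != 0 by rewrite expf_neq0.
  apply: (mulfI hr); rewrite mulrCA lQ (exprNn (h n)) /g; ring.
have Qc : Q @ \oo --> (1 : K).
  have -> : (1 : K) = 1 + c * (2 * 0) by rewrite !mulr0 addr0.
  apply: cvg_trans (_ : 1 + (Q n - 1) / (2 * h n) * (2 * h n) @[n --> \oo] --> _).
    by apply: near_eq_cvg; apply: nearW => n; field.
  apply: cvgD; first exact: cvg_cst.
  by apply: cvgM => //; apply: cvgM => //; exact: cvg_cst.
have w1 : w * (-1) ^+ r = 1.
  apply: (mulIf a00); apply: (@cvg_unique K (@norm_hausdorff K K) (Q n * g h n @[n --> \oo])).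
  - apply: cvg_trans (_ : w * (-1) ^+ r * g (fun n => - h n) n @[n --> \oo] --> _).
      by apply: near_eq_cvg; apply: filterS gQ.
    by apply: cvgM; [exact: cvg_cst|exact: gc].
  - by apply: cvgM => //; exact: gc.
(* Both c a0 and -a1 are limits of (Q - 1) g(h) / (2 h), since (Q - 1) g(h) = g(-h) - g(h). *)
apply: oppr_inj; rewrite mulNr opprK; apply/esym.
apply: (@cvg_unique K (@norm_hausdorff K K) ((Q n - 1) / (2 * h n) * g h n @[n --> \oo])).
- by apply: cvgM => //; exact: gc.
- apply: cvg_trans (_ : - a1 + (- e (- h n) - e (h n)) * 2^-1 @[n --> \oo] --> _).
    apply: near_eq_cvg; apply: filterS gQ => n; rewrite w1 mul1r => gQ.
    have -> : (Q n - 1) / (2 * h n) * g h n = (Q n * g h n - g h n) / (2 * h n) by ring.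
    rewrite gQ /g; field; exact: h0.
  rewrite [X in _ --> X](_ : - a1 = - a1 + (- 0 - 0) * 2^-1); last by rewrite oppr0 addr0 mul0r addr0.
  apply: cvgD; first exact: cvg_cst.
  apply: cvgM; last exact: cvg_cst.
  by apply: cvgB; [apply: cvgN; exact: (ec (fun n => - h n))|exact: ec].
Qed.

Lemma near_translate (K : numFieldType) (c : K) (P : set K) :
  (\forall s \near c, P s) -> \forall s \near (0 : K), P (c + s).
Proof.
move=> [d /= d0 dP]; exists d => // s /=; rewrite sub0r normrN => sd.
by apply: dP; rewrite /= opprD addNKr normrN.
Qed.

(** * The completed L-function at real points near 1 *)

Section CompletedLFunction.
Variables (R : realType) (K : fieldExtType rat) (E : weier K).
Local Notation n := (\dim {:K}).
Local Notation toC := (real_complex R : R -> cplx R).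

Lemma ln_cond_B : ln (cond_B R E) =
  1 / 2 * ln (cond_norm E)%:R + ln `|ratr (disc K)| - n%:R * ln (2 * pi).
Proof.
have N0 : 0 < (cond_norm E)%:R :> R by rewrite ltr0n cond_norm_gt0.
have D0 : 0 < `|ratr (disc K)| :> R by rewrite normr_gt0 fmorph_eq0 disc_neq0.
have : 0 < 2 * pi :> R by rewrite mulr_gt0// pi_gt0.
rewrite /cond_B; move: (2 * pi) _%:R `|_| N0 D0 => p x y x0 y0 p0.
rewrite ln_div ?posrE ?mulr_gt0 ?sqrtr_gt0 ?exprn_gt0// lnXn// mulr_natl.
rewrite lnM ?posrE ?sqrtr_gt0//; congr (_ + _ - _).
have : ln (Num.sqrt x ^+ 2) = ln (Num.sqrt x) *+ 2 by rewrite lnXn ?sqrtr_gt0.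
by rewrite sqr_sqrtr ?ltW// => ->; field.
Qed.

Lemma completedL_near1 (L : cplx R -> cplx R) h : - 2^-1 <= h ->
  exists2 S, completedL E L (1 + toC h) =
    toC (expR ((1 + h) * ln (cond_B R E) + n%:R * (S - h * euler_gamma R))) * L (1 + toC h)
  & 0 <= S <= 4 * h ^+ 2.
Proof.
move=> h2; have [S GS Sb] := cGamma_near1 h2; exists S => //.
have hE : 1 + toC h = toC (1 + h) by rewrite rmorphD rmorph1.
rewrite /completedL GS {1}hE cpow_toC -rmorphXn -rmorphM.
by rewrite -expRM_natl -expRD.
Qed.

Lemma gamma_pole_near1 h : - 1 < h -> ~ gamma_pole (1 + toC h).
Proof.
move=> h1 [k] /(congr1 (@complex.Re R)).
have -> : - k%:R = toC (- k%:R) by rewrite rmorphN rmorph_nat.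
have -> : 1 + toC h = toC (1 + h) by rewrite rmorphD rmorph1.
rewrite /= => e; have : 0 <= k%:R :> R by []; lra.
Qed.

End CompletedLFunction.

Theorem theorem1 (R : realType) (K : fieldExtType rat) (E : weier K)
  (hE : elliptic E)
  (U : set (cplx R)) (L : cplx R -> cplx R)
  (U_open : open U) (U_connected : connected U)
  (U_half_plane : forall s : cplx R, 3 / 2 < complex.Re s -> U s)
  (U_one : U 1) (U_stable : forall s : cplx R, U s -> U (2 - s))
  (L_holomorphic : forall s : cplx R, U s -> derivable L s 1)
  (L_extends : forall s : cplx R, 3 / 2 < complex.Re s ->
    L s = euler_product E s)
  (w : cplx R) (hw : w = 1 \/ w = -1)
  (L_functional : forall s : cplx R, U s -> ~ gamma_pole s ->
    ~ gamma_pole (2 - s) ->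
    completedL E L s = w * completedL E L (2 - s))
  (r : nat) (a : nat -> cplx R)
  (a_taylor : \forall s \near (1 : cplx R),
    series (fun k : nat => a k * (s - 1) ^+ k) @ \oo --> L s)
  (a_lt : forall k : nat, (k < r)%N -> a k = 0) (a_r : a r != 0) :
  a r.+1 =
    real_complex R ((\dim {:K})%:R * (euler_gamma R + ln (2 * pi))
       - 1 / 2 * ln (cond_norm E)%:R - ln `|ratr (disc K)|) * a r.
Proof.
set n := \dim {:K}; pose toC := real_complex R : R -> cplx R.
(* The shift by 2 gives h <= 1/2, so the Gamma estimate applies at both h and -h. *)
pose h (m : nat) : R := m.+2%:R^-1.
have h0 m : 0 < h m by rewrite invr_gt0 ltr0n.
have h2 m : h m <= 2^-1 by rewrite lef_pV2 ?posrE// ler_nat.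
have hc : h @ \oo --> 0.
  by have := @cvg_harmonic R; rewrite -[harmonic @ _ --> _]cvg_shiftS.
have hCc : (toC \o h) @ \oo --> (0 : cplx R).
  by have := cvg_toC hc; rewrite rmorph0.
have [S SE] : exists S : R -> R, forall x, - 2^-1 <= x ->
    completedL E L (1 + toC x) =
    toC (expR ((1 + x) * ln (cond_B R E) + n%:R * (S x - x * euler_gamma R))) * L (1 + toC x)
    /\ 0 <= S x <= 4 * x ^+ 2.
  have SE x : exists S, - 2^-1 <= x -> completedL E L (1 + toC x) =
    toC (expR ((1 + x) * ln (cond_B R E) + n%:R * (S - x * euler_gamma R))) * L (1 + toC x)
    /\ 0 <= S <= 4 * x ^+ 2.
    have [x2|x2] := leP (- 2^-1) x; last by exists 0.
    by have [S SE Sb] := completedL_near1 E L x2; exists S.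
  by have [S ?] := choice SE; exists S.
(* [c] is the logarithmic derivative of F at 0, and [t] is defined so that 2 h t is the logarithm of
   F(h) / F(-h). *)
pose c := ln (cond_B R E) - n%:R * euler_gamma R.
pose t m := c + n%:R * ((S (h m) - S (- h m)) / (2 * h m)).
(* Both remainders lie in [0, 4 h^2], hence so does the absolute value of their difference. *)
have Sh m : `|(S (h m) - S (- h m)) / (2 * h m)| <= 2 * h m.
  have hm := h0 m; have hm2 := h2 m.
  have [|_ Sp] := SE (h m); first by lra.
  have [|_ Sn] := SE (- h m); first by lra.
  rewrite sqrrN in Sn; rewrite normrM normfV [`|2 * _|]gtr0_norm ?mulr_gt0//.
  rewrite ler_pdivrMr ?mulr_gt0// ler_norml; nra.
have tc : t @ \oo --> c.
  rewrite -[X in _ --> X]addr0 -(mulr0 n%:R); apply: cvgD; first exact: cvg_cst.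
  apply: cvgM; first exact: cvg_cst.
  apply: (@cvg0_le_norm _ _ (fun m => 2 * h m)); first exact: nearW.
  by rewrite -(mulr0 2); apply: cvgM => //; exact: cvg_cst.
pose Q m := expR (2 * h m * t m).
have Qc : (fun m => (toC (Q m) - 1) / (2 * toC (h m))) @ \oo --> toC c.
  have : (fun m => (Q m - 1) / (2 * h m)) @ \oo --> c.
    apply: expR_quotient_cvg => // [m|]; first by rewrite mulr_gt0.
    by rewrite -(mulr0 2); apply: cvgM => //; exact: cvg_cst.
  move=> /cvg_toC; rewrite (_ : (fun m => toC _) = fun m => (toC (Q m) - 1) / (2 * toC (h m)))//.
  by apply/funext => m; rewrite /toC rmorphM fmorphV rmorphB rmorph1 rmorphM rmorph_nat.
pose l (s : cplx R) := L (1 + s).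
have [M lb] : exists M : cplx R, \forall s \near (0 : cplx R),
    `|l s - \sum_(k < r.+2) a k * s ^+ k| <= M * `|s| ^+ r.+2.
  apply: power_series_tail.
  have : \forall s \near (0 : cplx R),
    series (fun k : nat => a k * (1 + s - 1) ^+ k) @ \oo --> L (1 + s)
    by apply: near_translate a_taylor.
  by apply: filterS => s; rewrite [1 + s]addrC addrK [s + 1]addrC.
have lQ : \forall m \near \oo, toC (Q m) * l (toC (h m)) = w * l (- toC (h m)).
  have : \forall m \near \oo, U (1 + toC (h m)).
    have U1 : \forall s \near (1 : cplx R), U s by exact: open_nbhs_nbhs.
    exact: hCc (near_translate U1).
  move=> Un; near=> m; have Um : U (1 + toC (h m)) by near: m.
  have hm := h0 m; have hm2 := h2 m.
  have [|Fp _] := SE (h m); first by lra.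
  have [|Fn _] := SE (- h m); first by lra.
  have refl : 2 - (1 + toC (h m)) = 1 + toC (- h m) by rewrite /toC rmorphN; ring.
  have := L_functional _ Um; rewrite refl Fp Fn => fe.
  have {fe} := fe (gamma_pole_near1 _) (gamma_pole_near1 _).
  set A := (X in toC (expR X) * L (1 + toC (h m))).
  set B := (X in w * (toC (expR X) * _)) => fe.
  have {}fe : toC (expR A) * L (1 + toC (h m)) = w * (toC (expR B) * L (1 + toC (- h m))).
    by apply: fe; lra.
  (* [A] and [B] are the logarithms of F(h) and F(-h). *)
  have AB : 2 * h m * t m = A - B by rewrite /t /c /A /B; field; exact: lt0r_neq0.
  have eB0 : toC (expR B) != 0 by rewrite /toC fmorph_eq0 expR_eq0.
  rewrite /l /Q AB expRB; apply: (mulfI eB0).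
  have -> : toC (expR A / expR B) = toC (expR A) / toC (expR B).
    by rewrite /toC rmorphM fmorphV.
  have <- : toC (- h m) = - toC (h m) by rewrite /toC rmorphN.
  by rewrite mulrA mulrCA mulfV// mulr1 fe mulrCA.
have -> : real_complex R (n%:R * (euler_gamma R + ln (2 * pi)) - 1 / 2 * ln (cond_norm E)%:R
    - ln `|ratr (disc K)|) = - toC c.
  by rewrite /toC -rmorphN; congr (real_complex R _); rewrite /c ln_cond_B -/n; ring.
apply: (@reflection_leading_coefs _ l r _ _ _ w M (toC \o h) _ _ hCc Qc _ lQ a_r).
  by move=> m; rewrite /toC fmorph_eq0 gt_eqF.
(* The coefficients below index r vanish, so the sum of the first r + 2 terms reduces to its last
   two. *)
apply: filterS lb => s; rewrite !big_ord_recr /= big1 ?add0r// => k _.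
by rewrite a_lt ?mul0r.
Unshelve. all: by end_near. Qed.
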